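(* Let $K\subset\mathbb{R}^N$ be a convex body containing the origin in its interior, and let $G\subset\mathbb{R}^N$ be a bounded $K$-dense set. Then $G$ is strictly convex. Moreover, let $\mu$ be a Borel, locally finite measure on $[0,\infty)$ such that the function $\phi(t)=\mu([0,t))$ is convex and strictly increasing, and let $$f^\phi(x)=\int_G\phi(\|y-x\|_K)\,dy,\qquad x\in\mathbb{R}^N.$$ Then $G$ is a regular level set for $f^\phi$; that is, there is a number $s>\min_{\mathbb{R}^N}f^\phi$ such that $\{x: f^\phi(x)<s\}\subseteq G\subseteq\{x: f^\phi(x)\le s\}$ and $\partial G=\{x: f^\phi(x)=s\}$.
   Context: A convex body is a compact convex set with nonempty interior. $V$ denotes Lebesgue measure in $\mathbb{R}^N$. The gauge of $K$ is $\|x\|_K=\min\{r\ge 0: x\in rK\}$. For $x\in\mathbb{R}^N$ and $r>0$ let $\delta_K(x,r)=V(G\cap(x+rK))/V(rK)$. A measurable set $G$ with $V(G)>0$ is called $K$-dense if there is a function $c:(0,\infty)\to(0,\infty)$ such that $\delta_K(x,r)=c(r)$ for every $(x,r)\in\partial G\times(0,\infty)$, where $\partial G$ is the topological boundary of $G$. A set is strictly convex if it is convex and its boundary contains no nondegenerate segment. ''Regular level set'' for the convex function $f^\phi$ means a sublevel set (up to points of the boundary) at a level $s$ that is not the minimum of $f^\phi$. *)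

(* Defs.v *)
From HB Require Import structures.
From mathcomp Require Import all_boot all_order all_algebra.
From mathcomp Require Import all_classical all_reals all_analysis.
Set Implicit Arguments.
Unset Strict Implicit.
Unset Printing Implicit Defensive.
Import Order.TTheory GRing.Theory Num.Theory.
Import numFieldNormedType.Exports.
Local Open Scope classical_set_scope.
Local Open Scope ring_scope.
Local Open Scope convex_scope.

(* R^N, with N >= 1, is 'rV[R]_N.+1 throughout; its library norm is the sup
   norm, which induces the usual topology and the usual bounded sets. *)

Definition closed_box (R : realType) (N : nat)
    (B : 'rV[R]_N.+1 * 'rV[R]_N.+1) : set 'rV[R]_N.+1 :=
  [set x | forall i, B.1 ord0 i <= x ord0 i <= B.2 ord0 i].

Definition box_volume (R : realType) (N : nat)
    (B : 'rV[R]_N.+1 * 'rV[R]_N.+1) : R :=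
  \prod_(i < N.+1) (B.2 ord0 i - B.1 ord0 i).

(* Coverings use only boxes with ordered bounds: otherwise [box_volume] could
   be negative, or positive for an empty box. *)
Definition box_cover (R : realType) (N : nat) (A : set 'rV[R]_N.+1) :
    set (nat -> 'rV[R]_N.+1 * 'rV[R]_N.+1) :=
  [set B : nat -> 'rV[R]_N.+1 * 'rV[R]_N.+1 |
           (forall k i, (B k).1 ord0 i <= (B k).2 ord0 i) /\
           A `<=` \bigcup_k closed_box (B k)].

Definition lebesgue_outer (R : realType) (N : nat) (A : set 'rV[R]_N.+1) :
    \bar R :=
  ereal_inf [set (\sum_(k <oo) (box_volume (B k))%:E)%E | B in box_cover A].

Section lebesgue_outer_measure.
Context (R : realType) (N : nat).
Local Notation V := 'rV[R]_N.+1.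
Local Open Scope ereal_scope.

Lemma box_cover_ge0 (A : set V) B k : box_cover A B ->
  0 <= (box_volume (B k))%:E.
Proof. by move=> [B0 _]; rewrite lee_fin prodr_ge0// => i _; rewrite subr_ge0. Qed.

Lemma lebesgue_outer_ge0 (A : set V) : 0 <= lebesgue_outer A.
Proof.
apply: le_ereal_inf_tmp => _ [B AB <-].
by apply: nneseries_ge0 => k _ _; exact: box_cover_ge0 AB.
Qed.

Lemma lebesgue_outer0 : lebesgue_outer (set0 : set V) = 0.
Proof.
apply/eqP; rewrite eq_le lebesgue_outer_ge0 andbT.
apply: ereal_inf_lbound; exists (fun=> (0%R, 0%R)).
  by split => // k i; rewrite /= !mxE.
apply: eseries0 => k _ _; congr EFin.
by rewrite /box_volume big_ord_recl /= !mxE subrr mul0r.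
Qed.

Lemma le_lebesgue_outer :
  {homo @lebesgue_outer R N : A B / A `<=` B >-> A <= B}.
Proof.
move=> A B AB; apply/ereal_inf_le_tmp => _ [F [F0 BF] <-].
by exists F => //; split => //; exact: subset_trans BF.
Qed.

Lemma lebesgue_outer_sigma_subadditive : sigma_subadditive (@lebesgue_outer R N).
Proof.
move=> A; have [[i ioo]|] := pselect (exists i, lebesgue_outer (A i) = +oo).
  rewrite (eseries_pinfty _ _ ioo) ?leey// => n _.
  by rewrite -ltNye (lt_le_trans _ (lebesgue_outer_ge0 _)).
rewrite -forallNE => Aoo.
suff add2e (e : {posnum R}) : lebesgue_outer (\bigcup_n A n) <=
    \sum_(i <oo) lebesgue_outer (A i) + e%:num%:E.
  by apply/lee_addgt0Pr => _/posnumP[].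
rewrite (le_trans _ (epsilon_trick _ _ _))//; last first.
  by move=> n; exact: lebesgue_outer_ge0.
pose P n B := box_cover (A n) B /\ \sum_(k <oo) (box_volume (B k))%:E <=
  lebesgue_outer (A n) + (e%:num / (2 ^ n.+1)%:R)%:E.
have [G PG] : {G : nat -> nat -> V * V & forall n, P n (G n)}.
  apply: (@choice _ _ P) => n.
  have en1 : (0 < e%:num / (2 ^ n.+1)%:R :> R)%R by [].
  have fin : lebesgue_outer (A n) \is a fin_num.
    by rewrite ge0_fin_numE ?lebesgue_outer_ge0// ltey; apply/eqP/Aoo.
  have [_ [B AB <-] BA] := lb_ereal_inf_adherent en1 fin.
  by exists B; split => //; exact: ltW.
have G0 n k : 0 <= (box_volume (G n k))%:E by exact: box_cover_ge0 (PG n).1.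
apply: (@le_trans _ _ (\sum_(n <oo) \sum_(k <oo) (box_volume (G n k))%:E)).
  have /card_esym/ppcard_eqP[f] := card_nat2.
  apply: ereal_inf_lbound; exists (fun k => G (f k).1 (f k).2).
    split=> [k i|x [n _ /(PG n).1.2[k _ ?]]]; first exact: (PG (f k).1).1.1.
    by exists (f^-1%FUN (n, k)) => //=; rewrite invK ?inE.
  rewrite nneseries_esumT// nneseries_esumT; last first.
    by move=> n; exact: nneseries_ge0.
  under [RHS]eq_esum do rewrite nneseries_esumT//.
  rewrite esum_esum//= (_ : _ `*`` _ = setT); last by apply/seteqP; split.
  rewrite (@reindex_esum _ _ _ setT setT f)//.
apply: lee_nneseries => [n _ _|n _]; first exact: nneseries_ge0.
exact: (PG n).2.
Qed.

HB.instance Definition _ := isOuterMeasure.Build R V (@lebesgue_outer R N)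
  lebesgue_outer0 lebesgue_outer_ge0 le_lebesgue_outer
  lebesgue_outer_sigma_subadditive.

End lebesgue_outer_measure.

Notation lebesgue_rV_type R N :=
  (caratheodory_type (@lebesgue_outer R N)).

(* N-dimensional Lebesgue measure; its measurable sets, the Caratheodory
   measurable sets of the outer measure, are all the Lebesgue-measurable sets
   (not only the Borel ones). *)
Definition lebesgue_rV (R : realType) (N : nat) :
  set (lebesgue_rV_type R N) -> \bar R := @lebesgue_outer R N.

Arguments lebesgue_rV : clear implicits.

HB.instance Definition _ (R : realType) (N : nat) :=
  isMeasure.Build _ (lebesgue_rV_type R N) R (lebesgue_rV R N)
    (@caratheodory_measure0 _ _ (@lebesgue_outer R N))
    (@caratheodory_measure_ge0 _ _ (@lebesgue_outer R N))
    (@caratheodory_measure_sigma_additive _ _ (@lebesgue_outer R N)).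

Definition lebesgue_measurable (R : realType) (N : nat)
  (A : set 'rV[R]_N.+1) : Prop := (@lebesgue_outer R N).-cara.-measurable A.

Definition boundary (T : topologicalType) (A : set T) : set T :=
  closure A `\` A°.

Definition segment (R : realType) (N : nat) (x y : 'rV[R]_N.+1) :
    set 'rV[R]_N.+1 :=
  [set (x : convex_lmodType 'rV[R]_N.+1) <| t |> y | t in [set: {i01 R}]].

Definition convex_body (R : realType) (N : nat) (K : set 'rV[R]_N.+1) : Prop :=
  [/\ compact K, convex_set (M := 'rV[R]_N.+1) K & K° !=set0].

Definition strictly_convex (R : realType) (N : nat) (G : set 'rV[R]_N.+1) :
    Prop :=
  convex_set (M := 'rV[R]_N.+1) G /\
  forall x y, x <> y -> ~ (segment x y `<=` boundary G).

Definition dilate (R : realType) (N : nat) (r : R) (K : set 'rV[R]_N.+1) :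
    set 'rV[R]_N.+1 := [set r *: k | k in K].

Definition translate (R : realType) (N : nat) (x : 'rV[R]_N.+1)
    (A : set 'rV[R]_N.+1) : set 'rV[R]_N.+1 := [set x + y | y in A].

(* For a convex body K with 0 in its interior the infimum is attained, hence
   is the minimum. *)
Definition gauge_norm (R : realType) (N : nat) (K : set 'rV[R]_N.+1)
    (x : 'rV[R]_N.+1) : R :=
  inf [set r | 0 <= r /\ dilate r K x].

Definition density (R : realType) (N : nat) (K G : set 'rV[R]_N.+1)
    (x : 'rV[R]_N.+1) (r : R) : R :=
  fine (lebesgue_rV R N (G `&` translate x (dilate r K))) /
  fine (lebesgue_rV R N (dilate r K)).

Definition K_dense (R : realType) (N : nat) (K G : set 'rV[R]_N.+1) : Prop :=
  [/\ lebesgue_measurable G,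
      (0 < lebesgue_rV R N G)%E &
      exists c : R -> R, forall r, 0 < r ->
        0 < c r /\ forall x, boundary G x -> density K G x r = c r].

(* A Borel measure on [0, +oo[ is a Borel measure on the line that gives no
   mass to ]-oo, 0[. *)
Definition supported_nonneg (R : realType)
    (mu : {measure set (measurableTypeR R) -> \bar R}) : Prop :=
  mu `]-oo, 0[%classic = 0%E.

Definition locally_finite_measure (R : realType)
    (mu : {measure set (measurableTypeR R) -> \bar R}) : Prop :=
  forall x : R, exists U : set R, [/\ open U, U x & (mu U < +oo)%E].

Definition distrib_fun (R : realType)
    (mu : {measure set (measurableTypeR R) -> \bar R}) (t : R) : R :=
  fine (mu `[0, t[%classic).

Definition f_phi (R : realType) (N : nat) (K G : set 'rV[R]_N.+1)
    (phi : R -> R) (x : 'rV[R]_N.+1) : R :=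
  \int[lebesgue_rV R N]_(y in G) phi (gauge_norm K (y - x)).

(* Main.v *)
(* Integrating over the law of the gauge, [f_phi] at [x] depends only on the
   numbers V(G /\ (x + rK)), r > 0; hence it takes a single value s on the
   boundary of G.  As it is convex, G lies in {f <= s}.  Every boundary or
   interior point of G lies in the support of G, and there the convexity
   inequality of f is strict, since the integrand for y close to that point
   gains a definite amount.

   A set of positive finite measure cannot be disjoint from all its dilates
   about a point z, so some point of G is strictly between z and another point
   of G; with z in G this produces a point of G where f < s.  The set {f < s} is
   then joined to that point by segments missing the boundary, so it lies in G,
   and the boundary is exactly {f = s}.  A segment in {f = s}, or one joining
   two points of G and leaving G, would contradict strict convexity at one of
   its points; one admissible phi, such as phi(t) = max(t, 0), suffices for the
   first claim. *)
Require Import Defs.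
From HB Require Import structures.
From mathcomp Require Import all_boot all_order all_algebra.
From mathcomp Require Import all_classical all_reals all_analysis.
From mathcomp Require Import measurable_realfun ring lra.
Import Order.TTheory GRing.Theory Num.Theory.
Import numFieldNormedType.Exports.
Local Open Scope classical_set_scope.
Local Open Scope ring_scope.
Set Implicit Arguments.
Unset Strict Implicit.
Unset Printing Implicit Defensive.

(** * Lebesgue outer measure *)

Section outer_measure.
Context (R : realType) (N : nat).
Local Notation V := 'rV[R]_N.+1.
Implicit Types (A X : set V) (x z : V) (B : V * V).

Lemma translate_dilateP z (l : R) A y : 0 < l ->
  translate z (dilate l A) y <-> A (l^-1 *: (y - z)).
Proof.
move=> l0; split=> [[_ [a Aa <-] <-]|Ay].
  by rewrite addrC addKr scalerA mulVf ?gt_eqF// scale1r.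
exists (y - z); last by rewrite addrC subrK.
by exists (l^-1 *: (y - z)) => //; rewrite scalerA divff ?gt_eqF// scale1r.
Qed.

Lemma lebesgue_measurableP A :
  lebesgue_measurable A <-> (@lebesgue_outer R N).-caratheodory A.
Proof. by []. Qed.

Lemma box_volume_ge0 B : (forall i, B.1 ord0 i <= B.2 ord0 i) ->
  0 <= box_volume B.
Proof. by move=> B0; apply: prodr_ge0 => i _; rewrite subr_ge0. Qed.

(** Scaling and shifting every box of a cover of [A] covers the image, and each box volume is
    multiplied by [l ^+ N.+1]. *)
Lemma lebesgue_outer_affine_le z (l : R) A : 0 < l ->
  (lebesgue_outer (translate z (dilate l A)) <=
   (l ^+ N.+1)%:E * lebesgue_outer A)%E.
Proof.
move=> l0; rewrite -lee_pdivrMl ?exprn_gt0//.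
apply: le_ereal_inf_tmp => _ [B [B0 AB] <-].
rewrite lee_pdivrMl ?exprn_gt0//.
pose B' k := (z + l *: (B k).1, z + l *: (B k).2).
rewrite -nneseriesZl; last by move=> k _; rewrite lee_fin box_volume_ge0.
apply: ereal_inf_lbound; exists B'.
  split=> [k i|y /(translate_dilateP _ _ _ l0)/AB[k _ Bk]].
    by rewrite !mxE lerD2l ler_pM2l.
  exists k => // i; move: (Bk i); rewrite !mxE ler_pdivlMl// ler_pdivrMl//.
  by rewrite lerBrDl lerBlDl.
apply: eq_eseriesr => k _; rewrite -EFinM; congr EFin.
have -> : l ^+ N.+1 = \prod_(i < N.+1) l by rewrite prodr_const card_ord.
rewrite /box_volume -big_split/=.
by apply: eq_bigr => i _; rewrite !mxE; ring.
Qed.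

Lemma translate_dilateK z (l : R) A : 0 < l ->
  translate (- l^-1 *: z) (dilate l^-1 (translate z (dilate l A))) = A.
Proof.
move=> l0; have lV0 : 0 < l^-1 by rewrite invr_gt0.
have E y : l^-1 *: (l^-1^-1 *: (y - (- l^-1 *: z)) - z) = y.
  by apply/rowP => i; rewrite !mxE; field; rewrite gt_eqF.
by apply/seteqP; split=> y; rewrite !translate_dilateP// E.
Qed.

(** The reverse inequality is the one-sided bound applied to the inverse affine map. *)
Lemma lebesgue_outer_affine z (l : R) A : 0 < l ->
  lebesgue_outer (translate z (dilate l A)) =
  ((l ^+ N.+1)%:E * lebesgue_outer A)%E.
Proof.
move=> l0; apply/eqP; rewrite eq_le lebesgue_outer_affine_le//=.
rewrite -{1}(translate_dilateK z A l0).
rewrite -lee_pdivlMl ?exprn_gt0// -exprVn.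
by apply: lebesgue_outer_affine_le; rewrite invr_gt0.
Qed.

(** Every test set [X] is the affine image of some [Y], so the Caratheodory equation for [X] is the
    one for [Y] multiplied by [l ^+ N.+1]. *)
Lemma lebesgue_measurable_affine z (l : R) A : 0 < l ->
  lebesgue_measurable A -> lebesgue_measurable (translate z (dilate l A)).
Proof.
move=> l0 /lebesgue_measurableP mA; apply/lebesgue_measurableP => X.
have lV0 : 0 < l^-1 by rewrite invr_gt0.
set w := - l^-1 *: z.
have XE : X = translate z (dilate l (translate w (dilate l^-1 X))).
  have := translate_dilateK w X lV0.
  suff -> : - l^-1^-1 *: w = z by rewrite invrK.
  by apply/rowP => i; rewrite !mxE; field; rewrite gt_eqF.
set Y := translate w _ in XE; clearbody Y.
have E (C : set V) : translate z (dilate l Y) `&` translate z (dilate l C) =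
    translate z (dilate l (Y `&` C)).
  by apply/seteqP; split=> y; rewrite /= !translate_dilateP.
have EC : ~` translate z (dilate l A) = translate z (dilate l (~` A)).
  by apply/seteqP; split=> y; rewrite /= !translate_dilateP.
rewrite XE EC !E !lebesgue_outer_affine// -ge0_muleDr ?lebesgue_outer_ge0//.
by congr (_ * _)%E; exact: mA.
Qed.

Lemma lebesgue_outer_box B : (forall i, B.1 ord0 i <= B.2 ord0 i) ->
  (lebesgue_outer (closed_box B) <= (box_volume B)%:E)%E.
Proof.
move=> B0; apply: ereal_inf_lbound.
(* Covers are infinite sequences, so the single box is padded with degenerate boxes of volume
   zero. *)
pose B' k : V * V := if k is 0%N then B else (0, 0).
have vol0 : box_volume (0 : V, 0 : V) = 0.
  by rewrite /box_volume big_ord_recl !mxE subrr mul0r.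
exists B'; first by split=> [[|k] i//|x Bx]; exists 0%N.
rewrite (nneseries_split 0 1)//; last first.
  by move=> k _; rewrite lee_fin; case: k => [|k]/=;
    rewrite ?vol0// box_volume_ge0.
rewrite eseries0 ?adde0//; last by move=> [|k]//= _ _; rewrite vol0.
by rewrite add0n big_nat1.
Qed.

Lemma bounded_le_coord A : bounded_set A ->
  exists2 M : R, 0 < M & forall x, A x -> `|x| <= M.
Proof.
move=> [M [_ MA]]; exists (`|M| + 1); first by rewrite ltr_wpDl.
by apply: MA; rewrite (le_lt_trans (ler_norm _))// ltrDl.
Qed.

Lemma mx_norm_leP x (M : R) : 0 <= M ->
  `|x| <= M <-> forall i, `|x ord0 i| <= M.
Proof.
move=> M0; rewrite {1}/Num.Def.normr/= mx_normrE.
split=> [/bigmax_leP[_ xM] i|xM].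
  exact: (xM (ord0, i)).
apply/bigmax_leP; split=> // -[i j] _ /=; rewrite (ord1 i); exact: xM.
Qed.

Lemma bounded_lebesgue_outer A : bounded_set A -> (lebesgue_outer A < +oo)%E.
Proof.
move=> /bounded_le_coord[M M0 AM].
pose B : V * V := (const_mx (- M), const_mx M).
have B0 i : B.1 ord0 i <= B.2 ord0 i by rewrite !mxE; lra.
apply: (@le_lt_trans _ _ (lebesgue_outer (closed_box B))).
  apply: le_lebesgue_outer => x /AM/mx_norm_leP xM i.
  by rewrite !mxE -ler_norml xM ?ltW.
by rewrite (le_lt_trans (lebesgue_outer_box B0))// ltry.
Qed.

Lemma lebesgue_outer_set1 x : lebesgue_outer [set x] = 0%E.
Proof.
apply/eqP; rewrite eq_le lebesgue_outer_ge0 andbT.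
have xx i : (x, x).1 ord0 i <= (x, x).2 ord0 i by [].
apply: le_trans (le_trans (lebesgue_outer_box xx) _).
  by apply: le_lebesgue_outer => _ -> i; rewrite /= lexx.
by rewrite /box_volume big_ord_recl subrr mul0r.
Qed.

(* Splitting a box at the coordinate value [a] gives two boxes with the same
   total volume; clipping [a] to the box keeps the bounds ordered. *)
Lemma halfspace_measurable i (a : R) :
  lebesgue_measurable [set x : V | x ord0 i <= a].
Proof.
apply/lebesgue_measurableP/le_caratheodory_measurable => X.
apply: le_ereal_inf_tmp => _ [B [B0 XB] <-].
pose c k := Num.max ((B k).1 ord0 i) (Num.min ((B k).2 ord0 i) a).
have cB k : (B k).1 ord0 i <= c k <= (B k).2 ord0 i.
  rewrite /c le_max lexx/= ge_max B0/=.
  by rewrite ge_min lexx.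
pose lo k : V * V := ((B k).1,
  \row_j if j == i then c k else (B k).2 ord0 j).
pose hi k : V * V := (\row_j (if j == i then c k else (B k).1 ord0 j),
  (B k).2).
have lo0 k j : (lo k).1 ord0 j <= (lo k).2 ord0 j.
  by rewrite /= mxE; case: eqP => // ->; case/andP: (cB k).
have hi0 k j : (hi k).1 ord0 j <= (hi k).2 ord0 j.
  by rewrite /= mxE; case: eqP => // ->; case/andP: (cB k).
have volE k : (box_volume (B k))%:E =
    ((box_volume (lo k))%:E + (box_volume (hi k))%:E)%E.
  have volD C : box_volume C = (C.2 ord0 i - C.1 ord0 i) *
      \prod_(j < N.+1 | j != i) (C.2 ord0 j - C.1 ord0 j).
    by rewrite /box_volume (bigD1 i).
  rewrite -EFinD !volD/= !mxE eqxx.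
  under [X in _ = ((_ * X + _)%R)%:E]eq_bigr => j /negbTE ji do rewrite mxE ji.
  under [X in _ = ((_ + _ * X)%R)%:E]eq_bigr => j /negbTE ji do rewrite mxE ji.
  by congr EFin; ring.
under eq_eseriesr do rewrite volE.
rewrite nneseriesD; last 2 first.
- by move=> k _; rewrite lee_fin box_volume_ge0.
- by move=> k _; rewrite lee_fin box_volume_ge0.
apply: leeD; apply: ereal_inf_lbound.
  exists lo => //; split=> // x [/XB[k _ Bx] /= xa]; exists k => // j.
  rewrite /= mxE; case: eqP => [->|_]; last exact: Bx.
  have /andP[-> h2] := Bx i; rewrite /c le_max le_min h2 xa orbT//.
exists hi => //; split=> // x [/XB[k _ Bx] /= /negP]; rewrite -ltNge => xa.
exists k => // j; rewrite /= mxE; case: eqP => [->|_]; last exact: Bx.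
have /andP[h1 ->] := Bx i; rewrite andbT /c ge_max h1/= ge_min (ltW xa) orbT//.
Qed.

(** An open set is the countable union of the half-open rational boxes it contains, and each such
    box is a finite intersection of differences of half-spaces. *)
Lemma open_measurable_rV A : open A -> lebesgue_measurable A.
Proof.
move=> Aop.
pose cube (pq : 'rV[rat]_N.+1 * 'rV[rat]_N.+1) : set V :=
  [set x | forall i, ratr (pq.1 ord0 i) < x ord0 i <= ratr (pq.2 ord0 i)].
pose F pq : set (lebesgue_rV_type R N) :=
  if `[< cube pq `<=` A >] then cube pq else set0.
have -> : A = \bigcup_pq F pq.
  apply/seteqP; split=> [x Ax|x [pq _]]; last first.
    by rewrite /F; case: asboolP => // cA /cA.
  have /nbhs_ballP[e /= e0 eA] := open_nbhs_nbhs (conj Aop Ax).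
  have lo i : exists q : rat, x ord0 i - e < ratr q < x ord0 i.
    have [|q] := @rat_in_itvoo R (x ord0 i - e) (x ord0 i); first lra.
    by rewrite in_itv/=; exists q.
  have hi i : exists q : rat, x ord0 i < ratr q < x ord0 i + e.
    have [|q] := @rat_in_itvoo R (x ord0 i) (x ord0 i + e); first lra.
    by rewrite in_itv/=; exists q.
  have [p pP] := choice lo; have [q qP] := choice hi.
  exists (\row_i p i, \row_i q i) => //; rewrite /F.
  case: asboolP => [_|[]]; last first.
    move=> y cy;     apply: eA; split=> // i j.
    rewrite (ord1 i) /ball/= ltr_norml.
    by move: (cy j) (pP j) (qP j); rewrite !mxE /=; lra.
  by move=> i; rewrite !mxE /=; move: (pP i) (qP i); lra.
apply: countable_bigcupT_measurable; first exact: countableP.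
move=> pq; rewrite /F; case: asboolP => _; last exact: measurable0.
have -> : cube pq = \bigcap_(i in [set: 'I_N.+1])
    ([set x | x ord0 i <= ratr (pq.2 ord0 i)] `\`
     [set x | x ord0 i <= ratr (pq.1 ord0 i)]).
  apply/seteqP; split=> [x cx i _|x cx i].
    by have /andP[? ?] := cx i; split => //=; apply/negP; rewrite -ltNge.
  by have [/= -> /negP] := cx i I; rewrite -ltNge => ->.
apply: (@fin_bigcap_measurable _ (lebesgue_rV_type R N)) => // i _.
by apply: measurableD; exact: halfspace_measurable.
Qed.

Lemma closed_measurable_rV A : closed A -> lebesgue_measurable A.
Proof.
move=> Acl; rewrite -(setCK A).
by apply: (@measurableC _ (lebesgue_rV_type R N)); apply: open_measurable_rV;
  exact: closed_openC.
Qed.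

(* Otherwise the dilates of [A \ {z}] about [z] would be pairwise disjoint. *)
Lemma exists_segment_in A z : lebesgue_measurable A -> bounded_set A ->
  (0 < lebesgue_outer A)%E ->
  exists a b (t : R), [/\ A a, A b, b <> z, 0 < t < 1 & a = z + t *: (b - z)].
Proof.
move=> mA bA A0; apply: contrapT => noseg.
have [M M0 AM] := bounded_le_coord bA.
(* Infinitely many distinct ratios in []1/2, 1]]: the upper bound keeps all dilates in one bounded
   set, the lower bound keeps their measures away from zero. *)
pose c (k : nat) : R := 2^-1 + (2 * k.+1%:R)^-1.
have c0 k : 2^-1 < c k <= 1.
  rewrite /c ltrDl invr_gt0 mulr_gt0//= invfM.
  have : (k.+1%:R : R)^-1 <= 1 by rewrite invf_le1// ler1n.
  by move: (k.+1%:R^-1 : R) => r r1; lra.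
have cgt0 k : 0 < c k by move: (c0 k); lra.
have c_decr j k : (j < k)%N -> c k < c j.
  move=> jk; rewrite /c ltrD2l ltf_pV2 ?posrE ?mulr_gt0//.
  by rewrite ltr_pM2l// ltr_nat.
pose A' := A `\ z.
pose D k : set (lebesgue_rV_type R N) :=
  translate ((1 - c k) *: z) (dilate (c k) A').
have mA' : lebesgue_measurable A'.
  apply: (@measurableD _ (lebesgue_rV_type R N)) => //.
  apply: closed_measurable_rV; apply: compact_closed; last exact: compact_set1.
  exact: norm_hausdorff.
have A'0 : (0 < lebesgue_outer A')%E.
  apply: (lt_le_trans A0).
  apply: (@le_trans _ _ (lebesgue_outer (A' `|` [set z]))).
    apply: le_lebesgue_outer => x Ax.
    by have [->|/eqP xz] := eqVneq x z; [right|left; split].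
  apply: le_trans (outer_measureU2 _ _ _) _.
  by rewrite [X in (_ + X)%E](lebesgue_outer_set1 z) adde0.
have mD k : measurable (D k) by apply: lebesgue_measurable_affine.
have disj j k x : (j < k)%N -> D j x -> D k x -> False.
  move=> jk /translate_dilateP-/(_ (cgt0 _))[Aj zj].
  move=> /translate_dilateP-/(_ (cgt0 _))[Ak zk]; apply: noseg.
  (* The two preimages [a], [b] of the common point [x] satisfy [a - z = (c k / c j) *: (b - z)],
     with a ratio below 1. *)
  exists ((c j)^-1 *: (x - (1 - c j) *: z)).
  exists ((c k)^-1 *: (x - (1 - c k) *: z)).
  exists (c k / c j); split => //.
    by rewrite divr_gt0//= ltr_pdivrMr// mul1r c_decr.
  by apply/rowP => i; rewrite !mxE; field; rewrite !gt_eqF.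
have tD : trivIset setT D.
  move=> j k _ _ [x [Djx Dkx]].
  by have [jk|kj|//] := ltngtP j k; exfalso;
    [exact: disj jk Djx Dkx|exact: disj kj Dkx Djx].
pose U := [set x : V | `|x| <= M + `|z|].
have DU k : D k `<=` U.
  move=> _ [_ [a [/AM aM _] <-] <-].
  rewrite /U /= (le_trans (ler_normD _ _))// !normrZ.
  have h := c0 k; have := normr_ge0 z; have := normr_ge0 a.
  rewrite !ger0_norm; [|lra..].
  by move=> a0 z0; nra.
have Ufin : (lebesgue_outer U < +oo)%E.
  apply: bounded_lebesgue_outer; exists (M + `|z|).
  split; first exact: num_real.
  by move=> r Mr x /= xU; rewrite (le_trans xU)// ltW.
have A'U : (lebesgue_outer A' < +oo)%E.
  apply: (le_lt_trans _ (bounded_lebesgue_outer bA)).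
  by apply: le_lebesgue_outer => x [].
have sumD n : (\sum_(k < n) lebesgue_outer (D k) <= lebesgue_outer U)%E.
  have := @measure_bigsetU _ _ _ (lebesgue_rV R N) D mD tD n.
  rewrite /lebesgue_rV => <-.
  by apply: le_lebesgue_outer; rewrite -bigcup_mkord => x [k _ /DU].
have A'E : lebesgue_outer A' = (fine (lebesgue_outer A'))%:E.
  by rewrite fineK// ge0_fin_numE// ltW.
have UE : lebesgue_outer U = (fine (lebesgue_outer U))%:E.
  by rewrite fineK// ge0_fin_numE// lebesgue_outer_ge0.
set a := fine (lebesgue_outer A') in A'E.
set u := fine (lebesgue_outer U) in UE.
have a0 : 0 < a by rewrite -lte_fin -A'E.
(* Disjoint dilates inside [U], each of measure at least [2^-1 ^+ N.+1 * a], contradict the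
   Archimedean property. *)
have sumn n : n%:R * (2^-1 ^+ N.+1 * a) <= u.
  rewrite -lee_fin -UE (le_trans _ (sumD n))// mulr_natl.
  rewrite -[in X in (X <= _)%E](card_ord n) -sumr_const -sumEFin.
  apply: lee_sum => // k _.
  rewrite lebesgue_outer_affine// A'E -EFinM lee_fin ler_pM2r//.
  by rewrite lerXn2r ?nnegrE ?ltW//; have /andP[] := c0 k.
have b0 : 0 < 2^-1 ^+ N.+1 * a by rewrite mulr_gt0// exprn_gt0.
have := sumn (Num.Def.archi_bound (u / (2^-1 ^+ N.+1 * a))).
apply/negP; rewrite -ltNge -ltr_pdivrMr//.
by rewrite archi_boundP// divr_ge0 ?(ltW b0)// fine_ge0// lebesgue_outer_ge0.
Qed.

End outer_measure.

(** * Boundary points and gauges *)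

Section boundary_points.
Context (R : realType) (N : nat).
Local Notation V := 'rV[R]_N.+1.
Implicit Types (A : set V) (x p v : V).

Lemma nbhs_line (P : set V) p v : nbhs p P ->
  exists2 h : R, 0 < h & forall t, `|t| <= h -> P (p + t *: v).
Proof.
move=> /nbhs_ballP[e /= e0 eP].
have v1 : 0 < `|v| + 1 by rewrite ltr_wpDl.
exists (e / 2 / (`|v| + 1)); first by rewrite !divr_gt0.
move=> t; rewrite ler_pdivlMr// => te; apply: eP.
rewrite -ball_normE/= opprD addrA subrr add0r normrN normrZ.
by move: (normr_ge0 t) (normr_ge0 v) => t0 v0; nra.
Qed.

(** The boundary point is found at the supremum of the parameters whose points lie in [A]. *)
Lemma segment_meets_boundary A x z : A x -> ~ A z ->
  exists2 t : R, 0 <= t <= 1 & boundary A (x + t *: (z - x)).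
Proof.
move=> Ax Az; pose S := [set t : R | 0 <= t <= 1 /\ A (x + t *: (z - x))].
have S0 : S 0 by split; rewrite ?lexx ?ler01// scale0r addr0.
have S1 : ubound S 1 by move=> t [/andP[]].
have hS : has_sup S by split; [exists 0|exists 1].
have sup0 : 0 <= sup S by apply: sup_upper_bound.
have sup1 : sup S <= 1 by apply: ge_sup => //; exists 0.
exists (sup S); first by rewrite sup0.
split=> [B /(nbhs_line (z - x))[h h0 hB]|/(nbhs_line (z - x))[h h0 hA]].
  (* Closure: parameters in [S] come arbitrarily close to [sup S]. *)
  have [t [t01 At] tS] := sup_adherent h0 hS.
  exists (x + t *: (z - x)); split => //.
  have -> : x + t *: (z - x) = x + sup S *: (z - x) + (t - sup S) *: (z - x).
    by apply/rowP => i; rewrite !mxE; ring.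
  apply: hB; have : t <= sup S by apply: sup_upper_bound.
  by rewrite ler_norml => ?; lra.
have shift t : x + (sup S + t) *: (z - x) =
    x + sup S *: (z - x) + t *: (z - x) by rewrite scalerDl addrA.
(* Not interior: at [sup S = 1] the point is [z], outside [A]; below 1, an interior point would
   allow a parameter of [S] beyond [sup S]. *)
have [s1|s1] := eqVneq (sup S) 1.
  apply: Az; have := hA 0; rewrite normr0 scale0r addr0 s1 scale1r addrC subrK.
  by apply; exact: ltW.
pose t := Num.min h (1 - sup S).
have s1' : sup S < 1 by rewrite lt_neqAle s1.
have t0 : 0 < t by rewrite /t lt_min h0 subr_gt0.
have th : t <= h by rewrite /t ge_min lexx.
have ts : t <= 1 - sup S by rewrite /t ge_min lexx orbT.
have : S (sup S + t).
  split; first by apply/andP; split; lra.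
  by rewrite shift; apply: hA; rewrite ger0_norm// ltW.
by move/(sup_upper_bound hS); lra.
Qed.

Lemma bounded_boundary_exists A v : v != 0 -> bounded_set A -> forall x, A x ->
  exists2 t : R, 0 <= t & boundary A (x + t *: v).
Proof.
move=> v0 /bounded_le_coord[M M0 AM] x Ax.
(* Chosen so that [s *: v] has norm [M + |x| + 1], which carries [x] beyond the bound [M] on [A]. *)
pose s := (M + `|x| + 1) / `|v|.
have nv0 : 0 < `|v| by rewrite normr_gt0.
have s0 : 0 <= s by rewrite divr_ge0// !addr_ge0// ltW.
have nA : ~ A (x + s *: v).
  move=> /AM; apply/negP; rewrite -ltNge.
  have : `|s *: v| = M + `|x| + 1.
    by rewrite normrZ ger0_norm// /s divfK// gt_eqF.
  have : `|s *: v| <= `|x + s *: v| + `|x|.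
    by rewrite -[X in `|X| <= _](addKr x) addrC (le_trans (ler_normB _ _)).
  lra.
have [t /andP[t0 t1]] := segment_meets_boundary Ax nA.
rewrite [x + s *: v - x]addrC addKr scalerA => ?.
by exists (t * s) => //; rewrite mulr_ge0.
Qed.

Lemma convE (x y : V) (t : {i01 R}) :
  conv t (x : convex_lmodType V) y = t%:num *: x + (1 - t%:num) *: y.
Proof. by []. Qed.

Lemma convex_setP A : convex_set (M := V) A <->
  forall x y (t : R), A x -> A y -> 0 <= t <= 1 -> A (t *: x + (1 - t) *: y).
Proof.
split=> [cA x y t Ax Ay /andP[t0 t1]|cA x y t /set_mem Ax /set_mem Ay].
  exact: set_mem (cA x y (Itv01 t0 t1) (mem_set Ax) (mem_set Ay)).
by apply: mem_set; rewrite convE; apply: cA => //; apply/andP; split.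
Qed.

End boundary_points.

(** * The gauge of a convex body with the origin in its interior *)

Section gauge.
Context (R : realType) (N : nat) (K : set 'rV[R]_N.+1).
Hypotheses (K_body : convex_body K) (K_origin : K° 0).
Local Notation V := 'rV[R]_N.+1.
Local Notation gauge := (gauge_norm K).
Implicit Types (u v x : V) (r : R).

Let K_convex u v (t : R) : K u -> K v -> 0 <= t <= 1 ->
  K (t *: u + (1 - t) *: v).
Proof. by move=> *; case: K_body => _ /convex_setP + _; exact. Qed.

Let K0 : K 0. Proof. exact: interior_subset K_origin. Qed.

Let K_shrink u (t : R) : K u -> 0 <= t <= 1 -> K (t *: u).
Proof. by move=> Ku t01; have := K_convex Ku K0 t01; rewrite scaler0 addr0. Qed.

Lemma dilateP r u : 0 < r -> dilate r K u <-> K (r^-1 *: u).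
Proof.
by move=> r0; have := translate_dilateP 0 K u r0;
  rewrite subr0 => <-; split=> [?|[w ? <-]]; [exists u; rewrite ?add0r|
  rewrite add0r].
Qed.

Let K_ball : exists2 e : R, 0 < e & forall u, `|u| < e -> K u.
Proof.
move: K_origin => /nbhs_ballP[e /= e0 eK]; exists e => // u ue.
by apply: eK; rewrite -ball_normE/= sub0r normrN.
Qed.

Let gauge_set u := [set r | 0 <= r /\ dilate r K u].

Let gauge_set_lb u : lbound (gauge_set u) 0. Proof. by move=> r []. Qed.

Let gauge_set_nonempty u : gauge_set u !=set0.
Proof.
have [e e0 eK] := K_ball; have u1 : 0 < `|u| + 1 by rewrite ltr_wpDl.
exists ((`|u| + 1) / e); split; first by rewrite divr_ge0// ltW.
apply/dilateP; first by rewrite divr_gt0.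
apply: eK; rewrite normrZ ger0_norm ?invr_ge0 ?divr_ge0 ?ltW//.
by rewrite invf_div mulrAC ltr_pdivrMr// ltr_pM2l// ltrDl.
Qed.

Lemma gauge_ge0 u : 0 <= gauge u.
Proof. exact: lb_le_inf (gauge_set_nonempty u) (@gauge_set_lb u). Qed.

Lemma gauge_le_of r u : 0 < r -> K (r^-1 *: u) -> gauge u <= r.
Proof.
move=> r0 Ku; apply: ge_inf; first by exists 0; exact: gauge_set_lb.
by split; [exact: ltW|exact/dilateP].
Qed.

(** Some [s < r] has [u] in [s K], and [K] is star-shaped about 0 by convexity. *)
Lemma gauge_lt_dilate r u : gauge u < r -> K (r^-1 *: u).
Proof.
move=> ur; have r0 : 0 < r by exact: le_lt_trans (gauge_ge0 u) ur.
have [||s [s0 [k Kk <-]]] := @inf_adherent _ (gauge_set u) (r - gauge u).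
- by rewrite subr_gt0.
- by split; [exact: gauge_set_nonempty|exists 0; exact: gauge_set_lb].
rewrite addrC subrK => sr; rewrite scalerA; apply: K_shrink => //.
by rewrite mulr_ge0 ?invr_ge0 ?(ltW r0)//= mulrC ler_pdivrMr// mul1r ltW.
Qed.

(** The infimum is attained because [K] is closed. *)
Lemma gauge_leP r u : 0 < r -> gauge u <= r <-> K (r^-1 *: u).
Proof.
move=> r0; split; last exact: gauge_le_of.
move=> ur; apply: contrapT => nK.
have Kcl : closed K.
  by apply: compact_closed; [exact: norm_hausdorff|case: K_body].
have nKn : nbhs (r^-1 *: u) (~` K).
  by apply: open_nbhs_nbhs; split => //; exact: closed_openC.
(* The complement of [K] also contains the slightly shrunk point [(r * (1 + h))^-1 *: u], although
   [gauge u < r * (1 + h)]. *)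
have [h h0 hK] := nbhs_line (r^-1 *: u) nKn.
have := hK (- (h / (1 + h))).
have h1 : 0 < 1 + h by rewrite addr_gt0.
have -> : r^-1 *: u + - (h / (1 + h)) *: (r^-1 *: u) = (r * (1 + h))^-1 *: u.
  by apply/rowP => i; rewrite !mxE; field; rewrite !gt_eqF.
apply; last first.
  by apply: gauge_lt_dilate; rewrite (le_lt_trans ur)// ltr_pMr// ltrDl.
rewrite normrN ger0_norm; last by rewrite divr_ge0// ltW.
by rewrite ler_pdivrMr// ler_peMr// ?lerDl ltW.
Qed.

Lemma gauge_ballE x r : 0 < r ->
  [set y | gauge (y - x) <= r] = translate x (dilate r K).
Proof.
move=> r0; apply/seteqP; split=> y /=.
  by move=> /gauge_leP -/(_ r0) ?; apply/translate_dilateP.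
by move=> /translate_dilateP -/(_ r0) ?; apply/gauge_leP.
Qed.

Lemma gauge_convex u v (t : R) : 0 <= t <= 1 ->
  gauge (t *: u + (1 - t) *: v) <= t * gauge u + (1 - t) * gauge v.
Proof.
move=> t01; apply/ler_addgt0Pr => e e0.
(* The slack [e] puts [a^-1 *: u] and [b^-1 *: v] in [K]; the rescaled combination is their convex
   combination with weights [t * a / c] and [(1 - t) * b / c]. *)
set a := gauge u + e; set b := gauge v + e.
have a0 : 0 < a by rewrite ltr_wpDl// gauge_ge0.
have b0 : 0 < b by rewrite ltr_wpDl// gauge_ge0.
have Ka : K (a^-1 *: u) by apply: gauge_lt_dilate; rewrite ltrDl.
have Kb : K (b^-1 *: v) by apply: gauge_lt_dilate; rewrite ltrDl.
set c := t * gauge u + (1 - t) * gauge v + e.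
have cE : c = t * a + (1 - t) * b by rewrite /c /a /b; ring.
have ta0 : 0 <= t * a by rewrite mulr_ge0 ?(ltW a0)//; case/andP: t01.
have tb0 : 0 <= (1 - t) * b by rewrite mulr_ge0 ?(ltW b0)//; lra.
have c0 : 0 < c.
  rewrite ltr_wpDl//; have := gauge_ge0 u; have := gauge_ge0 v => v0 u0.
  by case/andP: t01 => t0 t1; rewrite addr_ge0// mulr_ge0// subr_ge0.
apply: gauge_le_of => //.
have -> : c^-1 *: (t *: u + (1 - t) *: v) =
    (t * a / c) *: (a^-1 *: u) + (1 - t * a / c) *: (b^-1 *: v).
  have -> : 1 - t * a / c = (1 - t) * b / c.
    apply: (mulIf (lt0r_neq0 c0)); rewrite mulrBl !divfK ?lt0r_neq0//.
    by rewrite mul1r cE addrC addKr.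
  by apply/rowP => i; rewrite !mxE; field; rewrite !gt_eqF.
apply: K_convex => //; rewrite divr_ge0 ?(ltW c0)//= ler_pdivrMr// mul1r cE.
by rewrite lerDl.
Qed.

Lemma gaugeZ_le (a : R) u : 0 < a -> gauge (a *: u) <= a * gauge u.
Proof.
move=> a0; apply/ler_addgt0Pr => e e0.
have ae0 : 0 < e / a by rewrite divr_gt0.
have -> : a * gauge u + e = a * (gauge u + e / a) by field; rewrite gt_eqF.
have g0 : 0 < gauge u + e / a by rewrite ltr_wpDl// gauge_ge0.
apply: gauge_le_of; first by rewrite mulr_gt0.
rewrite invfM scalerA mulrAC mulVf ?gt_eqF// mul1r.
by apply: gauge_lt_dilate; rewrite ltrDl.
Qed.

Lemma gauge_triangle u v : gauge (u + v) <= gauge u + gauge v.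
Proof.
have -> : u + v = 2 *: (2^-1 *: u + (1 - 2^-1) *: v).
  by apply/rowP => i; rewrite !mxE; field.
apply: le_trans (gaugeZ_le _ _) _ => //.
have -> : gauge u + gauge v = 2 * (2^-1 * gauge u + (1 - 2^-1) * gauge v).
  by field.
by rewrite ler_pM2l//; apply: gauge_convex; lra.
Qed.

Lemma gauge_norm_equiv : exists a b : R, [/\ 0 < a, 0 < b &
  forall u, a * `|u| <= gauge u <= b * `|u|].
Proof.
have [M M0 KM] : exists2 M : R, 0 < M & forall x, K x -> `|x| <= M.
  by apply: bounded_le_coord; case: K_body => /compact_bounded.
have [e e0 eK] := K_ball.
(* [K] has norm bound [M] and contains the open ball of radius [e]; the factor 2 brings the rescaled
   vector to norm [e / 2], strictly inside that ball. *)
exists M^-1, (2 / e); split; rewrite ?invr_gt0 ?divr_gt0// => u.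
apply/andP; split.
  rewrite ler_pdivrMl//; apply/ler_addgt0Pr => d d0.
  have dM : 0 < d / M by rewrite divr_gt0.
  have g0 : 0 < gauge u + d / M by rewrite ltr_wpDl// gauge_ge0.
  have -> : M * gauge u + d = (gauge u + d / M) * M by field; rewrite gt_eqF.
  have : K ((gauge u + d / M)^-1 *: u) by apply: gauge_lt_dilate; rewrite ltrDl.
  by move=> /KM; rewrite normrZ gtr0_norm ?invr_gt0// ler_pdivrMl.
have [->|u0] := eqVneq u 0.
  rewrite normr0 mulr0; apply/ler_addgt0Pr => d d0; rewrite add0r.
  by apply: gauge_le_of => //; rewrite scaler0.
have nu0 : 0 < `|u| by rewrite normr_gt0.
apply: gauge_le_of; first by rewrite mulr_gt0// divr_gt0.
apply: eK; rewrite normrZ gtr0_norm; last first.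
  by rewrite invr_gt0 mulr_gt0// divr_gt0.
by rewrite invfM invf_div -mulrA mulVf ?gt_eqF// mulr1; lra.
Qed.

End gauge.

(** * The convex function [f_phi] *)

Section equidistribution.
Context d (T : measurableType d) (R : realType).
Variables (mu : {measure set T -> \bar R}) (D : set T).
Hypotheses (mD : measurable D) (D_fin : (mu D < +oo)%E).
Local Open Scope ereal_scope.

Let law (g : T -> measurableTypeR R) (mg : measurable_fun setT g) :
    {measure set (measurableTypeR R) -> \bar R} :=
  measure_function_pushforward__canonical__measure_function_Measure
    (mrestr mu mD) mg.

Let integral_law (g : T -> measurableTypeR R) (mg : measurable_fun setT g)
    (phi : R -> R) : measurable_fun setT phi -> (forall t, 0 <= phi t)%R ->
  \int[mu]_(y in D) (phi (g y))%:E = \int[law mg]_t (phi t)%:E.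
Proof.
move=> mphi phi0.
have mh : measurable_fun setT (EFin \o (phi \o g)).
  exact/measurable_EFinP/(measurableT_comp mphi mg).
rewrite [RHS](ge0_integral_pushforward mg)//; last 2 first.
- exact/measurable_EFinP.
- by move=> t _; rewrite lee_fin.
rewrite preimage_setT [RHS](@ge0_negligible_integral _ _ _ _ _ (~` D))//.
- rewrite setTD setCK; apply: eq_measure_integral => A _ AD.
  by rewrite /= /mrestr setIidl.
- exact: measurableC.
- by move=> y _; rewrite lee_fin.
- by rewrite /= /mrestr setICl measure0.
Qed.

(** Both sides are integrals of [phi] against the laws of [g] and [h] on [D]; these laws agree on
    the rays []r, +oo[], an intersection-stable generator of the Borel sets. *)
Lemma eq_integral_equidistributed (g h : T -> R) (phi : R -> R) :
  measurable_fun setT g -> measurable_fun setT h ->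
  (forall r, mu (D `&` [set y | (g y <= r)%R]) =
             mu (D `&` [set y | (h y <= r)%R])) ->
  measurable_fun setT phi -> (forall t, 0 <= phi t)%R ->
  \int[mu]_(y in D) (phi (g y))%:E = \int[mu]_(y in D) (phi (h y))%:E.
Proof.
move=> mg mh gh mphi phi0; rewrite !integral_law//.
have mle (k : T -> R) : measurable_fun setT k -> forall r : R,
    measurable [set y : T | (k y <= r)%R].
  move=> mk r; rewrite -[X in measurable X]setTI.
  have -> : [set y | (k y <= r)%R] = k @^-1` `]-oo, r]%classic.
    by apply/seteqP; split=> y /=; rewrite in_itv.
  exact: mk.
have lawE k (mk : measurable_fun setT k) r : law mk `]r, +oo[%classic =
    mu D - mu (D `&` [set y | (k y <= r)%R]).
  rewrite -measureD//; last exact: mle.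
  congr (mu _); apply/seteqP; split=> y /=.
    rewrite in_itv/= andbT => -[kr Dy].
    by split => //; apply/negP; rewrite -ltNge.
  by move=> [Dy /negP]; rewrite -ltNge in_itv/= andbT => ?; split.
apply: eq_measure_integral => A mA _.
pose rays : set (set (measurableTypeR R)) := @RGenOInfty.G R.
(* Rays of finite mass exhausting the line, for the uniqueness theorem for measures. *)
pose c n : set (measurableTypeR R) := `](- n%:R)%R, +oo[%classic.
have raysI : setI_closed rays.
  move=> _ _ [x ->] [y ->]; exists (Num.max x y).
  by apply/seteqP; split=> z /=; rewrite !in_itv/= !andbT gt_max => /andP.
have c_rays n : rays (c n) by exists (- n%:R)%R.
have c_cover : \bigcup_n c n = setT.
  apply/seteqP; split=> // x _; exists (Num.Def.archi_bound `|x|%R) => //=.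
  rewrite /c/= in_itv/= andbT; apply: (@lt_le_trans _ _ (- `|x|)%R).
    by rewrite ltrN2 archi_boundP.
  by rewrite lerNl (le_trans (ler_norm _))// normrN.
have laws A' : rays A' -> law mg A' = law mh A'.
  by move=> [x ->]; rewrite !lawE gh.
have law_fin n : (law mg (c n) < +oo)%E.
  rewrite lawE; apply: le_lt_trans D_fin.
  by rewrite geeDl// leeNl oppe0 measure_ge0//.
have mG : @measurable _ (measurableTypeR R) = <<s rays >>.
  exact: RGenOInfty.measurableE.
exact: (measure_unique rays c mG raysI c_rays c_cover (law mg) (law mh)).
Qed.

End equidistribution.

(** * Convexity, continuity and minimum of [f_phi] *)

Section functional.
Context (R : realType) (N : nat) (K G : set 'rV[R]_N.+1) (phi : R -> R).
Hypotheses (K_body : convex_body K) (K_origin : K° 0).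
Hypotheses (mG : lebesgue_measurable G) (G_bounded : bounded_set G).
Hypothesis phi_homo : {homo phi : s t / s <= t}.
Hypothesis phi_ge0 : forall t, 0 <= phi t.
Hypothesis phi_incr : forall s t, 0 <= s -> s < t -> phi s < phi t.
Hypothesis phi_convex : forall s t l, 0 <= s -> 0 <= t -> 0 <= l <= 1 ->
  phi (l * s + (1 - l) * t) <= l * phi s + (1 - l) * phi t.

Local Notation V := 'rV[R]_N.+1.
Local Notation gauge := (gauge_norm K).
Local Notation mu := (lebesgue_rV R N).
Local Notation f := (f_phi K G phi).
Local Notation T := (lebesgue_rV_type R N).
Implicit Types (x y z : V) (r : R).

Let gauge_ge0 := gauge_ge0 K_origin.

Let G_fin : (mu G < +oo)%E. Proof. exact: bounded_lebesgue_outer. Qed.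

Let measurable_K_ball x r : 0 < r ->
  lebesgue_measurable (translate x (dilate r K)).
Proof.
move=> r0; apply: lebesgue_measurable_affine => //; apply: closed_measurable_rV.
by apply: compact_closed; [exact: norm_hausdorff|case: K_body].
Qed.

Lemma bounded_integrable_on_G (h : T -> R) (c : R) :
  measurable_fun setT h -> (forall y, G y -> `|h y| <= c) ->
  mu.-integrable G (EFin \o h).
Proof.
move=> mh hc.
apply: (@measurable_bounded_integrable _ T R mu h G mG G_fin).
  exact: measurable_funTS.
exists c; split; first exact: num_real.
by move=> e ce y /= Gy; exact: le_trans (hc _ Gy) (ltW ce).
Qed.

Lemma measurable_gauge x :
  measurable_fun setT (fun y : T => gauge (y - x)).
Proof.
apply: (@measurability _ _ T (measurableTypeR R) _ _ (@RGenOInfty.G R)).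
  exact: RGenOInfty.measurableE.
move=> _ [_ [r ->] <-]; rewrite setTI.
have -> : (fun y : T => gauge (y - x)) @^-1` `]r, +oo[%classic =
    ~` [set y : T | gauge (y - x) <= r].
  apply/seteqP; split=> y /=; rewrite in_itv/= andbT.
    by move=> ry; apply/negP; rewrite -ltNge.
  by move=> /negP; rewrite -ltNge.
(* The sublevel set is a translated dilate of [K] for [r > 0], empty for [r < 0], and the singleton
   of [x] for [r = 0]. *)
apply: measurableC; have [r0|r0|r0] := ltgtP 0 r.
- by rewrite (gauge_ballE K_body K_origin)//; exact: measurable_K_ball.
- rewrite (_ : [set _ | _] = set0); first exact: measurable0.
  apply/seteqP; split=> // y /=; apply/negP; rewrite -ltNge.
  exact: lt_le_trans r0 (gauge_ge0 _).
- apply: closed_measurable_rV; rewrite -r0.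
  rewrite (_ : [set _ | _] = [set x]).
    by apply: compact_closed; [exact: norm_hausdorff|exact: compact_set1].
  have [a [b [a0 b0 ab]]] := gauge_norm_equiv K_body K_origin.
  apply/seteqP; split=> y /=.
    move=> y0; have /andP[+ _] := ab (y - x).
    move=> /le_trans/(_ y0); rewrite pmulr_rle0// normr_le0 subr_eq0.
    by move/eqP.
  by move=> ->; have /andP[_] := ab (x - x); rewrite subrr normr0 mulr0.
Qed.

Lemma measurable_phi : measurable_fun setT phi.
Proof. exact: nondecreasing_measurable. Qed.

Lemma gauge_le_bounded : exists2 b : R, 0 < b & exists2 M : R, 0 < M &
  (forall x, gauge x <= b * `|x|) /\
  forall x y, G y -> gauge (y - x) <= b * (M + `|x|).
Proof.
have [a [b [_ b0 ab]]] := gauge_norm_equiv K_body K_origin.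
have [M M0 GM] := bounded_le_coord G_bounded.
exists b => //; exists M => //; split=> [x|x y /GM yM].
  by case/andP: (ab x).
have /andP[_ /le_trans] := ab (y - x); apply; rewrite ler_pM2l//.
by rewrite (le_trans (ler_normB _ _))// lerD2r.
Qed.

Lemma integrable_phi x :
  mu.-integrable G (EFin \o (fun y : T => phi (gauge (y - x)))).
Proof.
have [b b0 [M M0 [_ Gb]]] := gauge_le_bounded.
apply: (@bounded_integrable_on_G _ (phi (b * (M + `|x|)))).
  exact: measurableT_comp measurable_phi (measurable_gauge x).
by move=> y Gy; rewrite ger0_norm// phi_homo// Gb.
Qed.

Lemma integrable_convex_comb x1 x2 (l : R) : mu.-integrable G
  (EFin \o (fun y : T => l * phi (gauge (y - x1)) +
                         (1 - l) * phi (gauge (y - x2)))).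
Proof.
have := integrableD mG (integrableZl mG l (integrable_phi x1))
  (integrableZl mG (1 - l) (integrable_phi x2)).
by apply: eq_integrable => // y _.
Qed.

Lemma f_phi_convex_comb x1 x2 (l : R) : l * f x1 + (1 - l) * f x2 =
  \int[mu]_(y in G) (l * phi (gauge (y - x1)) + (1 - l) * phi (gauge (y - x2))).
Proof.
have h c x : mu.-integrable G
    (EFin \o (fun y : T => c * phi (gauge (y - x)))).
  have := integrableZl mG c (integrable_phi x).
  by apply: eq_integrable => // y _.
rewrite RintegralD// !RintegralZl//; exact: integrable_phi.
Qed.

Lemma gauge_convex_sub x1 x2 y (l : R) : 0 <= l <= 1 ->
  gauge (y - (l *: x1 + (1 - l) *: x2)) <=
  l * gauge (y - x1) + (1 - l) * gauge (y - x2).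
Proof.
move=> l01.
have -> : y - (l *: x1 + (1 - l) *: x2) = l *: (y - x1) + (1 - l) *: (y - x2).
  by apply/rowP => i; rewrite !mxE; ring.
exact: gauge_convex.
Qed.

Lemma phi_gauge_convex x1 x2 y (l : R) : 0 <= l <= 1 ->
  phi (l * gauge (y - x1) + (1 - l) * gauge (y - x2)) <=
  l * phi (gauge (y - x1)) + (1 - l) * phi (gauge (y - x2)).
Proof. by move=> l01; apply: phi_convex. Qed.

(** The gauge is convex and [phi] is monotone and convex, so the inequality already holds between
    the integrands. *)
Lemma f_phi_convex x1 x2 (l : R) : 0 <= l <= 1 ->
  f (l *: x1 + (1 - l) *: x2) <= l * f x1 + (1 - l) * f x2.
Proof.
move=> l01; rewrite f_phi_convex_comb; apply: le_Rintegral => //.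
- exact: integrable_phi.
- exact: integrable_convex_comb.
- move=> y _; apply: le_trans (phi_gauge_convex _ _ _ l01).
  by apply: phi_homo; exact: gauge_convex_sub.
Qed.

(* The convexity inequality between the integrands has a uniform gap for [y]
   near [m], where [gauge (y - m)] is small but [gauge (y - x1)] is not. *)
Lemma f_phi_strictly_convex_at x1 x2 (l : R) : 0 < l < 1 -> x1 <> x2 ->
  let m := l *: x1 + (1 - l) *: x2 in
  (forall r, 0 < r -> (0 < mu (G `&` translate m (dilate r K)))%E) ->
  f m < l * f x1 + (1 - l) * f x2.
Proof.
move=> l01 x12 m suppm.
have l01' : 0 <= l <= 1 by lra.
have [a [b [a0 _ ab]]] := gauge_norm_equiv K_body K_origin.
pose w := a * `|m - x1|.
have w0 : 0 < w.
  rewrite mulr_gt0// normr_gt0 subr_eq0; apply/eqP => mx1; apply: x12.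
  have : (1 - l) *: (x2 - x1) = m - x1.
    by apply/rowP => i; rewrite !mxE; ring.
  rewrite mx1 subrr.
  move/eqP; rewrite scaler_eq0 !subr_eq0 => /orP[/eqP|/eqP->//].
  by move=> ?; exfalso; lra.
(* If [gauge (y - m) <= r], then [gauge (y - x1) >= w - r], so the averaged gauge is at least
   [l * (w - r) >= 3 * r]; passing from [r] to [2 * r] gains [d]. *)
pose r := l * w / 4.
have r0 : 0 < r by rewrite divr_gt0// mulr_gt0//; lra.
pose d := phi (2 * r) - phi r.
have d0 : 0 < d by rewrite subr_gt0 phi_incr//; lra.
pose P : set T := translate m (dilate r K).
have mP : measurable P by exact: measurable_K_ball.
have gap y : P y ->
    d + phi (gauge (y - m)) <=
    l * phi (gauge (y - x1)) + (1 - l) * phi (gauge (y - x2)).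
  rewrite /P -gauge_ballE// => /= ym.
  have y1 : w - r <= gauge (y - x1).
    have /andP[h1 _] := ab (y - m); have /andP[h2 _] := ab (y - x1).
    have : `|m - x1| <= `|y - x1| + `|y - m|.
      have -> : m - x1 = (y - x1) - (y - m).
        by apply/rowP => i; rewrite !mxE; ring.
      exact: ler_normB.
    rewrite -(ler_pM2l a0) mulrDr -/w; lra.
  have y2 := gauge_ge0 (y - x2).
  apply: le_trans (phi_gauge_convex _ _ _ l01').
  have /phi_homo : 2 * r <= l * gauge (y - x1) + (1 - l) * gauge (y - x2).
    have rE : 4 * r = l * w by rewrite /r; field.
    have lw : l * (w - r) <= l * gauge (y - x1) by rewrite ler_pM2l//; lra.
    have lr : l * r <= r by rewrite ler_piMl//; lra.
    have : 0 <= (1 - l) * gauge (y - x2) by rewrite mulr_ge0//; lra.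
    move: lw; rewrite mulrBr; lra.
  by move: (phi_homo ym); rewrite /d; lra.
have dint : mu.-integrable G (EFin \o (fun y : T => d * \1_P y)).
  apply: (@bounded_integrable_on_G _ d).
    by apply: (@measurable_funM _ T R setT (cst d)).
  move=> y _; rewrite normrM ger0_norm ?(ltW d0)// ler_piMr ?(ltW d0)// indicE.
  by case: (_ \in _); rewrite ?normr0 ?normr1.
(* The gap is used on [P] and plain convexity elsewhere; the total gain is [d] times the positive
   measure of [G] in [P]. *)
have lty : \int[mu]_(y in G) (d * \1_P y + phi (gauge (y - m))) <=
    l * f x1 + (1 - l) * f x2.
  rewrite f_phi_convex_comb; apply: le_Rintegral => //.
  - have := integrableD mG dint (integrable_phi m).
    by apply: eq_integrable => // y _.
  - exact: integrable_convex_comb.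
  - move=> y _; rewrite indicE; have [/set_mem Py|_] := boolP (y \in P).
      by rewrite mulr1; exact: gap.
    rewrite mulr0 add0r; apply: le_trans (phi_gauge_convex _ _ _ l01').
    by apply: phi_homo; exact: gauge_convex_sub.
apply: lt_le_trans lty; rewrite RintegralD//; last exact: integrable_phi.
rewrite ltrDr.
have -> : \int[mu]_(y in G) (d * \1_P y) = d * fine (mu (G `&` P)).
  rewrite RintegralZl//.
    by rewrite /Rintegral integral_indic// setIC.
  apply: (@bounded_integrable_on_G _ 1) => //.
  by move=> y _; rewrite indicE; case: (_ \in _); rewrite ?normr0 ?normr1.
rewrite mulr_gt0// fine_gt0// suppm//=.
apply: le_lt_trans G_fin; apply: le_lebesgue_outer; exact: subIsetl.
Qed.

(** The chord of [phi] from [u] to [c + 1] has length at least 1, so its slope is at most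
    [phi (c + 1)], [phi] being nonnegative. *)
Lemma phi_lipschitz u v (c : R) : 0 <= u -> u <= v -> v <= c ->
  phi v <= phi u + (v - u) * phi (c + 1).
Proof.
move=> u0 uv vc; have cu : 1 <= c + 1 - u by lra.
have cu0 : 0 < c + 1 - u by lra.
pose l := (v - u) / (c + 1 - u).
have l01 : 0 <= l <= 1.
  by rewrite /l divr_ge0 ?(ltW cu0) ?subr_ge0//= ler_pdivrMr// mul1r; lra.
have lvu : l <= v - u by rewrite ler_pdivrMr// ler_peMr// subr_ge0.
have -> : v = l * (c + 1) + (1 - l) * u by rewrite /l; field; rewrite gt_eqF.
have c1 : 0 <= c + 1 by lra.
apply: le_trans (phi_convex c1 u0 l01) _.
have -> : l * (c + 1) + (1 - l) * u - u = v - u.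
  by rewrite /l; field; rewrite gt_eqF.
have p0 := phi_ge0 u; have pc0 := phi_ge0 (c + 1).
have h1 : l * phi (c + 1) <= (v - u) * phi (c + 1) by rewrite ler_wpM2r.
have h2 : 0 <= l * phi u by rewrite mulr_ge0//; case/andP: l01.
by rewrite mulrBl mul1r; lra.
Qed.

Lemma f_phi_lipschitz (rho : R) : exists2 C : R, 0 <= C &
  forall x x', `|x| <= rho -> `|x'| <= rho -> f x' <= f x + C * `|x' - x|.
Proof.
have [b b0 [M M0 [gb Gb]]] := gauge_le_bounded.
(* Bounds every gauge [gauge (y - x')] with [y] in [G] and [|x'| <= rho], so one Lipschitz constant
   of [phi] serves all the integrands. *)
pose c := b * (M + rho).
exists (phi (c + 1) * b * fine (mu G)).
  by rewrite !mulr_ge0 ?(ltW b0)// fine_ge0// lebesgue_outer_ge0.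
move=> x x' xrho x'rho; set D := phi (c + 1) * b * `|x' - x|.
have -> : f x + phi (c + 1) * b * fine (mu G) * `|x' - x| =
    \int[mu]_(y in G) (phi (gauge (y - x)) + D).
  rewrite RintegralD//; last 2 first.
  - exact: integrable_phi.
  - by apply: (@bounded_integrable_on_G (cst D) `|D|).
  by rewrite Rintegral_cst// /D; congr (_ + _); ring.
apply: le_Rintegral => //.
- exact: integrable_phi.
- have := integrableD mG (integrable_phi x)
    (@bounded_integrable_on_G (cst D) `|D| (measurable_cst _)
      (fun _ _ => lexx _)).
  by apply: eq_integrable => // y _.
- move=> y Gy; have [le|lt] := leP (gauge (y - x')) (gauge (y - x)).
    rewrite (le_trans (phi_homo le))// lerDl.
    by rewrite /D !mulr_ge0// ltW.
  have gc : gauge (y - x') <= c.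
    by apply: le_trans (Gb _ _ Gy) _; rewrite ler_pM2l// lerD2l.
  apply: le_trans (phi_lipschitz _ (ltW lt) gc) _ => //.
  rewrite lerD2l /D mulrC -mulrA ler_wpM2l// -normrN opprB.
  rewrite lerBlDl; apply: le_trans (_ : _ <= gauge (y - x) + gauge (x - x')) _.
    by rewrite -{1}(subrK x y) -addrA; exact: gauge_triangle.
  by rewrite lerD2l.
Qed.

Lemma f_phi_continuous : continuous f.
Proof.
move=> x; have [C C0 Clip] := f_phi_lipschitz (`|x| + 1).
apply/(@cvgrPdist_le R R^o V (nbhs x) _ f (f x)) => e e0; apply/nbhs_ballP.
have C1 : 0 < C + 1 by rewrite ltr_wpDl.
(* The 1 keeps [x'] in the ball where [C] is valid; [C + 1] avoids dividing by zero. *)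
exists (Num.min 1 (e / (C + 1))) => /=; first by rewrite lt_min ltr01 divr_gt0.
move=> x'; rewrite -ball_normE/= lt_min => /andP[d1 d2].
have x'1 : `|x'| <= `|x| + 1.
  have := ler_normB x (x - x'); rewrite subKr => /le_trans; apply.
  by rewrite lerD2l ltW.
have x1 : `|x| <= `|x| + 1 by rewrite lerDl.
have := Clip _ _ x1 x'1; have := Clip _ _ x'1 x1; rewrite [`|x' - x|]distrC.
have : C * `|x - x'| <= e.
  apply: le_trans (_ : (C + 1) * `|x - x'| <= _).
    by rewrite ler_wpM2r// lerDl.
  by rewrite mulrC -ler_pdivlMr// ltW.
by move: (f x) (f x') (C * _) => p q s; rewrite ler_norml; lra.
Qed.

Lemma f_phi_has_min : exists x0, forall x, f x0 <= f x.
Proof.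
have [M M0 GM] := bounded_le_coord G_bounded.
have [a [b [a0 b0 ab]]] := gauge_norm_equiv K_body K_origin.
(* For [|x| > rho] and [y] in [G], [gauge (y - x) >= a * (rho - M) = b * M >= gauge y], hence
   [f 0 <= f x]; a minimum over the compact ball is therefore global. *)
pose rho := M + b * M / a.
have rho0 : 0 <= rho by rewrite addr_ge0 ?divr_ge0 ?mulr_ge0 ?ltW.
pose B : set V := [set x | `|x| <= rho].
have cB : compact B.
  apply: bounded_closed_compact.
    exists rho; split; first exact: num_real.
    by move=> c rc x /le_trans; apply; exact: ltW.
  rewrite (_ : B = Num.norm @^-1` [set t | t <= rho])//.
  apply: preimage_closed => [x _|]; first exact: norm_continuous.
  exact: closed_le.
have B0 : B 0 by rewrite /B/= normr0.
have [x0 _ x0min] := EVT_min_rV (ex_intro _ 0 B0) cB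
  (continuous_subspaceT f_phi_continuous).
exists x0 => x; have [xB|xB] := leP `|x| rho; first by apply/x0min/mem_set.
apply: le_trans (x0min 0 (mem_set B0)) _.
apply: le_Rintegral => // [||y Gy]; try exact: integrable_phi.
apply: phi_homo; rewrite subr0.
have /andP[_ h1] := ab y; have /andP[h2 _] := ab (y - x).
apply: le_trans h1 (le_trans _ h2).
have yM := GM _ Gy.
have h3 : `|x| <= `|y - x| + `|y|.
  by have := ler_normB y (y - x); rewrite subKr addrC.
have h4 : b * M <= a * `|y - x|.
  rewrite [leRHS]mulrC -ler_pdivrMr//.
  by move: xB; rewrite /rho; move: (b * M / a) => p; lra.
by apply: le_trans h4; rewrite ler_pM2l.
Qed.

Lemma f_phi_eq_of_density x x' :
  (forall r, 0 < r -> mu (G `&` translate x (dilate r K)) =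
                      mu (G `&` translate x' (dilate r K))) ->
  f x = f x'.
Proof.
move=> xx'.
have eq_law r : mu (G `&` [set y : T | gauge (y - x) <= r]) =
    mu (G `&` [set y : T | gauge (y - x') <= r]).
  have [r0|r0] := ltP 0 r.
    by rewrite !(gauge_ballE K_body K_origin _ r0); exact: xx'.
  (* For [r <= 0] the sublevel set lies in a single point, so both measures vanish. *)
  have null z : mu (G `&` [set y : T | gauge (y - z) <= r]) = 0%E.
    apply/eqP; rewrite eq_le lebesgue_outer_ge0 andbT.
    rewrite -(lebesgue_outer_set1 z); apply: le_lebesgue_outer => y [_ /= yr].
    have [a [b [a0 _ ab]]] := gauge_norm_equiv K_body K_origin.
    have /andP[+ _] := ab (y - z).
    move=> /le_trans/(_ (le_trans yr r0)).
    by rewrite pmulr_rle0// normr_le0 subr_eq0 => /eqP.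
  by rewrite !null.
have E := @eq_integral_equidistributed _ T R mu G mG G_fin _ _ phi
  (measurable_gauge x) (measurable_gauge x') eq_law measurable_phi phi_ge0.
by rewrite /f_phi /Rintegral E.
Qed.

End functional.

(** * K-dense sets *)

Section convex_combination_bounds.
Context (R : realType).
Implicit Types a b c l : R.

Lemma conv_le_bound a b c l : 0 <= l <= 1 -> a <= c -> b <= c ->
  l * a + (1 - l) * b <= c.
Proof.
move=> /andP[l0 l1] ac bc; have -> : c = l * c + (1 - l) * c by ring.
by rewrite lerD// ler_wpM2l// subr_ge0.
Qed.

Lemma conv_lt_bound a b c l : 0 < l <= 1 -> a < c -> b <= c ->
  l * a + (1 - l) * b < c.
Proof.
move=> /andP[l0 l1] ac bc; have -> : c = l * c + (1 - l) * c by ring.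
by rewrite ltr_leD// ?ltr_pM2l// ler_wpM2l// subr_ge0.
Qed.

Lemma itv01_ooW l : 0 < l < 1 -> 0 <= l <= 1.
Proof. by move=> /andP[/ltW-> /ltW->]. Qed.

End convex_combination_bounds.

Section K_dense_sets.
Context (R : realType) (N : nat) (K G : set 'rV[R]_N.+1).
Hypotheses (K_body : convex_body K) (K_origin : K° 0).
Hypotheses (G_bounded : bounded_set G) (G_dense : K_dense K G).

Local Notation V := 'rV[R]_N.+1.
Local Notation mu := (lebesgue_rV R N).
Implicit Types (x y z : V) (r : R).

Let mG : lebesgue_measurable G. Proof. by case: G_dense. Qed.

Let G_pos : (0 < mu G)%E. Proof. by case: G_dense. Qed.

Let G_ex : exists g, G g.
Proof.
apply: contrapT => nG; move: G_pos; suff -> : G = set0 by rewrite measure0 ltxx.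
by apply/seteqP; split=> // g Gg; apply: nG; exists g.
Qed.

Let const_mx1_neq0 : const_mx 1 != 0 :> V.
Proof.
by apply/eqP => /rowP/(_ ord0); rewrite !mxE => /eqP; rewrite oner_eq0.
Qed.

Let boundary_ex : exists p, boundary G p.
Proof.
have [g Gg] := G_ex.
by have [t _ bt] := bounded_boundary_exists const_mx1_neq0 G_bounded Gg;
  exists (g + t *: const_mx 1).
Qed.

Let fin_sub A : A `<=` G -> mu A \is a fin_num.
Proof.
move=> AG; rewrite ge0_fin_numE ?lebesgue_outer_ge0//.
exact: le_lt_trans (le_lebesgue_outer AG) (bounded_lebesgue_outer G_bounded).
Qed.

(** Since [c r > 0], the quotient is nonzero; as division by zero gives zero, neither numerator nor
    denominator vanishes. *)
Let density_pos x r : boundary G x -> 0 < r ->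
  (0 < mu (G `&` translate x (dilate r K)))%E /\ fine (mu (dilate r K)) != 0.
Proof.
move=> bx r0; have [_ _ [c cP]] := G_dense; have [c0 /(_ _ bx) cE] := cP _ r0.
have : density K G x r != 0 by rewrite cE gt_eqF.
rewrite /density mulf_eq0 invr_eq0 negb_or => /andP[n0 d0]; split=> //.
rewrite lt0e lebesgue_outer_ge0 andbT; apply: contra_neq n0.
by move=> h; rewrite [X in fine X]h.
Qed.

(** The common nonzero denominator cancels, and both measures are finite because [G] is bounded. *)
Let density_eq x x' r : boundary G x -> boundary G x' -> 0 < r ->
  mu (G `&` translate x (dilate r K)) = mu (G `&` translate x' (dilate r K)).
Proof.
move=> bx bx' r0; have [_ _ [c cP]] := G_dense; have [_ cE] := cP _ r0.
have [_ d0] := density_pos bx r0.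
have : density K G x r = density K G x' r by rewrite !cE.
move/(divIf d0) => e.
by rewrite -[LHS]fineK ?e ?fineK// fin_sub//; exact: subIsetl.
Qed.

Let K_pos : (0 < mu K)%E.
Proof.
have [p bp] := boundary_ex; have [_] := density_pos bp ltr01.
have -> : dilate 1 K = K.
  by apply/seteqP; split=> [_ [k Kk <-]|k Kk]; [|exists k]; rewrite ?scale1r.
rewrite lt0e lebesgue_outer_ge0 andbT; apply: contra_neq.
by move=> h; rewrite [X in fine X]h.
Qed.

(** At boundary points the density is positive; around any other point of [G] a small dilate of [K]
    lies inside [G]. *)
Lemma K_dense_support x r : G x \/ boundary G x -> 0 < r ->
  (0 < mu (G `&` translate x (dilate r K)))%E.
Proof.
move=> Gx r0; have [bx|nbx] := pselect (boundary G x).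
  by case: (density_pos bx r0).
have Gix : G° x.
  apply: contrapT => nGi; case: Gx => // Gx; apply: nbx; split => //.
  exact: subset_closure.
have [a [b [a0 _ ab]]] := gauge_norm_equiv K_body K_origin.
have /nbhs_ballP[e /= e0 eG] := Gix.
pose r' := Num.min r (a * e / 2).
have ae0 : 0 < a * e / 2 by rewrite !mulr_gt0// invr_gt0.
have r'0 : 0 < r' by rewrite lt_min r0.
apply: (@lt_le_trans _ _ (mu (translate x (dilate r' K)))).
  rewrite [X in (_ < X)%E]lebesgue_outer_affine// mule_gt0//.
  by rewrite lte_fin exprn_gt0.
apply: le_lebesgue_outer; rewrite -!(gauge_ballE K_body K_origin)// => y /= yr'.
split; last by rewrite (le_trans yr')// ge_min lexx.
apply: eG; rewrite -ball_normE/= distrC -(ltr_pM2l a0).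
have /andP[/le_lt_trans + _] := ab (y - x); apply.
apply: (le_lt_trans yr'); apply: (@le_lt_trans _ _ (a * e / 2)).
  by rewrite ge_min lexx orbT.
by have := mulr_gt0 a0 e0; lra.
Qed.

(** * The level set of [f_phi] bounded by the boundary of [G], and strict convexity *)

Variable phi : R -> R.
Hypothesis phi_homo : {homo phi : s t / s <= t}.
Hypothesis phi_ge0 : forall t, 0 <= phi t.
Hypothesis phi_incr : forall s t, 0 <= s -> s < t -> phi s < phi t.
Hypothesis phi_convex : forall s t l, 0 <= s -> 0 <= t -> 0 <= l <= 1 ->
  phi (l * s + (1 - l) * t) <= l * phi s + (1 - l) * phi t.

Local Notation f := (f_phi K G phi).

Let f_convex x1 x2 (l : R) : 0 <= l <= 1 ->
  f (l *: x1 + (1 - l) *: x2) <= l * f x1 + (1 - l) * f x2.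
Proof. exact: f_phi_convex. Qed.

Let f_strict x1 x2 (l : R) : 0 < l < 1 -> x1 <> x2 ->
  G (l *: x1 + (1 - l) *: x2) \/ boundary G (l *: x1 + (1 - l) *: x2) ->
  f (l *: x1 + (1 - l) *: x2) < l * f x1 + (1 - l) * f x2.
Proof.
move=> l01 x12 Gm; apply: f_phi_strictly_convex_at => // r r0.
exact: K_dense_support.
Qed.

Lemma f_phi_const_boundary x x' : boundary G x -> boundary G x' -> f x = f x'.
Proof.
by move=> bx bx'; apply: f_phi_eq_of_density => // r r0; exact: density_eq.
Qed.

(** A line through [x] meets the boundary in both directions, so [x] lies between two points of
    value [f p]. *)
Lemma f_phi_le_boundary x p : G x -> boundary G p -> f x <= f p.
Proof.
move=> Gx bp.
have nv0 : - const_mx 1 != 0 :> V by rewrite oppr_eq0 const_mx1_neq0.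
have [t t0 bt] := bounded_boundary_exists const_mx1_neq0 G_bounded Gx.
have [u u0 bu] := bounded_boundary_exists nv0 G_bounded Gx.
(* In this degenerate case both boundary points coincide with [x]. *)
have [tu|tu] := eqVneq (t + u) 0.
  have t00 : t = 0 by lra.
  by rewrite -(f_phi_const_boundary bt bp) t00 scale0r addr0.
have tu0 : 0 < t + u by rewrite lt_neqAle eq_sym tu addr_ge0.
pose l := u / (t + u).
have l01 : 0 <= l <= 1.
  by rewrite /l divr_ge0 ?(ltW tu0)//= ler_pdivrMr// mul1r lerDr.
have := f_convex (x + t *: const_mx 1) (x + u *: - const_mx 1) l01.
have -> : l *: (x + t *: const_mx 1) + (1 - l) *: (x + u *: - const_mx 1) = x.
  by apply/rowP => i; rewrite !mxE /l; field.
rewrite (f_phi_const_boundary bt bp) (f_phi_const_boundary bu bp).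
by move=> /le_trans; apply; exact: conv_le_bound.
Qed.

(** Strict convexity applies at a point of [G] strictly between two other points of [G], whose
    values are at most [f p]. *)
Lemma exists_lt_boundary p : boundary G p -> exists2 g, G g & f g < f p.
Proof.
move=> bp; have [z Gz] := G_ex.
have [a [b [t [Ga Gb bz t01 ab]]]] := exists_segment_in z mG G_bounded G_pos.
exists a => //.
have aE : a = t *: b + (1 - t) *: z.
  by rewrite ab; apply/rowP => i; rewrite !mxE; ring.
have : f a < t * f b + (1 - t) * f z.
  by rewrite aE; apply: f_strict => //; left; rewrite -aE.
have fb := f_phi_le_boundary Gb bp; have fz := f_phi_le_boundary Gz bp.
move=> /lt_le_trans; apply; apply: conv_le_bound fb fz.
exact: itv01_ooW.
Qed.

(** Otherwise the segment from a low point [g] of [G] to [x] would meet the boundary at a value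
    below [f p]. *)
Lemma lt_boundary_sub x p : boundary G p -> f x < f p -> G x.
Proof.
move=> bp xp; apply: contrapT => nGx.
have [g Gg gp] := exists_lt_boundary bp.
have [t t01 bt] := segment_meets_boundary Gg nGx.
have tE : g + t *: (x - g) = t *: x + (1 - t) *: g.
  by apply/rowP => i; rewrite !mxE; ring.
have := f_convex x g t01.
rewrite -tE (f_phi_const_boundary bt bp) leNgt => /negP; apply.
have [t0|t0] := eqVneq t 0; first by rewrite t0 mul0r add0r subr0 mul1r.
apply: conv_lt_bound (ltW gp) => //; case/andP: t01 => t0' ->.
by rewrite andbT lt_neqAle eq_sym t0.
Qed.

(** From a point [x] at the level, moving toward the low point [g] enters [{f < f p}], hence [G], so
    [x] is in the closure. Were [x] interior, the line from [g] could be prolonged past [x] within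
    [G], and convexity would force [f x < f p]. *)
Lemma boundary_eq_level p : boundary G p -> boundary G = [set x | f x = f p].
Proof.
move=> bp; apply/seteqP; split=> [x bx|x /= fx].
  exact: f_phi_const_boundary.
have [g Gg gp] := exists_lt_boundary bp.
split=> [B /(nbhs_line (g - x))[h h0 hB]|/(nbhs_line (x - g))[h h0 hG]].
  pose t := Num.min h 1.
  have t0 : 0 < t by rewrite lt_min h0 ltr01.
  have t1 : t <= 1 by rewrite ge_min lexx orbT.
  have th : t <= h by rewrite ge_min lexx.
  exists (x + t *: (g - x)); split; last by apply: hB; rewrite gtr0_norm.
  apply: (lt_boundary_sub bp).
  have tE : x + t *: (g - x) = t *: g + (1 - t) *: x.
    by apply/rowP => i; rewrite !mxE; ring.
  have t01 : 0 <= t <= 1 by rewrite ltW.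
  rewrite tE; apply: le_lt_trans (f_convex g x t01) _.
  by rewrite fx; apply: conv_lt_bound gp (lexx _); rewrite t0.
have : G (x + h *: (x - g)) by apply: hG; rewrite gtr0_norm.
move=> /f_phi_le_boundary-/(_ _ bp) le.
have h1 : 0 < 1 + h by rewrite addr_gt0.
pose l := h / (1 + h).
have l01 : 0 < l < 1.
  by rewrite /l divr_gt0//= ltr_pdivrMr// mul1r ltrDr.
have l01' := itv01_ooW l01.
have := f_convex g (x + h *: (x - g)) l01'.
have -> : l *: g + (1 - l) *: (x + h *: (x - g)) = x.
  by apply/rowP => i; rewrite !mxE /l; field; rewrite gt_eqF.
rewrite fx leNgt => /negP; apply; apply: conv_lt_bound gp le.
by case/andP: l01 => -> /ltW.
Qed.

Lemma K_dense_level_set : exists s : R,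
  [/\ exists2 x0, (forall x, f x0 <= f x) & f x0 < s,
      [set x | f x < s] `<=` G,
      G `<=` [set x | f x <= s] &
      boundary G = [set x | f x = s]].
Proof.
have [p bp] := boundary_ex; exists (f p); split.
- have [x0 x0min] : exists x0, forall x, f x0 <= f x by exact: f_phi_has_min.
  exists x0 => //; have [g _ gp] := exists_lt_boundary bp.
  exact: le_lt_trans (x0min g) gp.
- by move=> x; exact: lt_boundary_sub.
- by move=> x Gx; exact: f_phi_le_boundary.
- exact: boundary_eq_level.
Qed.

(** On a boundary segment, the ends and the midpoint would have equal values, against strictness at
    the midpoint. A chord point outside [G] has value at least [f p], hence exactly [f p] by
    convexity, so it is a boundary point, where strictness fails again. *)
Lemma K_dense_strictly_convex : strictly_convex G.
Proof.
have [p bp] := boundary_ex; have bE := boundary_eq_level bp.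
split=> [|x y xy sxy]; last first.
  have half01 : 0 < (2^-1 : R) < 1 by rewrite invr_gt0 ltr0n invf_lt1// ltr1n.
  have /andP[h01 h1] := itv01_ooW half01.
  have seg t : boundary G (conv t (x : convex_lmodType V) y).
    by apply: sxy; exists t.
  have bx : boundary G x.
    have := seg (Itv01 ler01 (lexx 1)).
    by rewrite convE/= subrr scale0r addr0 scale1r.
  have bdy : boundary G y.
    have := seg (Itv01 (lexx 0) ler01).
    by rewrite convE/= subr0 scale0r add0r scale1r.
  have := seg (Itv01 h01 h1); rewrite convE/= => bm.
  have : f (2^-1 *: x + (1 - 2^-1) *: y) < 2^-1 * f x + (1 - 2^-1) * f y.
    by apply: f_strict => //; right.
  rewrite (f_phi_const_boundary bx bp) (f_phi_const_boundary bdy bp).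
  by rewrite (f_phi_const_boundary bm bp) -mulrDl addrC subrK mul1r ltxx.
apply/convex_setP => x y t Gx Gy t01.
have [->|/eqP xy] := eqVneq x y; first by rewrite -scalerDl addrC subrK scale1r.
have [->|t0] := eqVneq t 0; first by rewrite scale0r add0r subr0 scale1r.
have [->|t1] := eqVneq t 1; first by rewrite subrr scale0r addr0 scale1r.
have t01' : 0 < t < 1.
  by move: t01; rewrite !le_eqVlt (eq_sym 0) (negbTE t0) (negbTE t1).
apply: contrapT => nGm.
have fx := f_phi_le_boundary Gx bp; have fy := f_phi_le_boundary Gy bp.
have fm : f p <= f (t *: x + (1 - t) *: y).
  by rewrite leNgt; apply/negP => /(lt_boundary_sub bp).
have fm' := f_convex x y t01.
have bm : boundary G (t *: x + (1 - t) *: y).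
  rewrite bE /=; apply/eqP; rewrite eq_le fm andbT.
  by apply: le_trans fm' _; exact: conv_le_bound.
have := f_strict t01' xy (or_intror bm); rewrite ltNge => /negP; apply.
by apply: le_trans fm; exact: conv_le_bound.
Qed.

End K_dense_sets.

Theorem theorem2p3 (R : realType) (N : nat) (K G : set 'rV[R]_N.+1)
    (K_body : convex_body K) (K_origin : K° 0)
    (G_bounded : bounded_set G) (G_dense : K_dense K G) :
  strictly_convex G /\
  forall mu : {measure set (measurableTypeR R) -> \bar R},
    supported_nonneg mu ->
    locally_finite_measure mu ->
    convex_function (E := R^o) `[0, +oo[%classic (distrib_fun mu) ->
    {in `[0, +oo[ &, {homo distrib_fun mu : s t / s < t}} ->
    let f := f_phi K G (distrib_fun mu) in
    exists s : R,
      [/\ exists2 x0, (forall x, f x0 <= f x) & f x0 < s,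
          [set x | f x < s] `<=` G,
          G `<=` [set x | f x <= s] &
          boundary G = [set x | f x = s]].
Proof.
split.
  apply: (@K_dense_strictly_convex _ _ K G K_body K_origin G_bounded G_dense
    (fun t => Num.max t 0)) => //.
  - by move=> s t st /=; rewrite ge_max !le_max st lexx orbT.
  - by move=> t; rewrite le_max lexx orbT.
  - by move=> s t s0 st; rewrite !max_l// ltW// (le_lt_trans s0).
  - move=> s t l s0 t0 /andP[l0 l1].
    by rewrite !max_l// addr_ge0// mulr_ge0// subr_ge0.
move=> mu _ _ mu_convex mu_incr f; apply: K_dense_level_set => //.
- move=> s t; rewrite le_eqVlt => /predU1P[->//|st].
  have [s0|s0] := leP 0 s.
    by apply/ltW/mu_incr => //; rewrite in_itv/= andbT// (le_trans s0)// ltW.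
  (* For [s < 0] the interval [[0, s[] is empty and the distribution function is 0, which extends
     monotonicity to the whole line. *)
  rewrite {1}/distrib_fun set_itv_ge ?measure0 ?fine_ge0//.
  by rewrite bnd_simp -leNgt ltW.
- by move=> t; rewrite fine_ge0.
- move=> s t s0 st; apply: mu_incr => //; rewrite in_itv/= andbT//.
  by rewrite (le_trans s0)// ltW.
- move=> s t l s0 t0 /andP[l0 l1].
  have := mu_convex (Itv01 l0 l1) s t; rewrite !inE/= !in_itv/= !andbT.
  by move=> /(_ s0 t0); rewrite !convRE.
Qed.
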